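(* Let $k\ge 1$ and let $\mathbf{n}=(n_1,\dots,n_k)\in\mathbb{Z}_{>0}^k$ with $n_1\ge n_2\ge\dots\ge n_k$. Let $E:=\{j\in\{1,\dots,k\}: n_j \text{ is even}\}$, $O:=\{1,\dots,k\}\setminus E$, and define $\mathbf{m}=(m_1,\dots,m_k)$ by $m_j:=\frac{n_j}{2}$ if $j\in E$ and $m_j:=\frac{n_j-1}{2}$ if $j\in O$. If $$\max\{n_j : j\in O\}\le \frac{k-1}{2}\min\{n_j: j\in E\}\quad\text{and}\quad \max\{n_j: j\in E\}\le k\min\{n_j: j\in E\},$$ then $\mathbf{n}\in\mathcal{H}(\mathbf{m})$. In particular, $\mathbf{n}$ is a lonely runner instance.
   Context: For $\mathbf{m}\in\mathbb{R}^k$, let $\mathcal{C}(\mathbf{m}):=\mathbf{m}+\left[\frac{1}{k+1},\frac{k}{k+1}\right]^k$, and let $\mathcal{H}(\mathbf{m})$ be the nonnegative span of $\mathcal{C}(\mathbf{m})$, i.e. $\mathcal{H}(\mathbf{m})=\{\lambda\mathbf{x}:\lambda\ge 0,\ \mathbf{x}\in\mathcal{C}(\mathbf{m})\}$ (a polyhedral cone). A vector $\mathbf{n}\in\mathbb{Z}_{>0}^k$ is a lonely runner instance if there exists a real number $t$ such that for all $1\le j\le k$ the distance of $tn_j$ to the nearest integer is at least $\frac{1}{k+1}$. A condition involving a maximum or minimum over an empty set is understood as vacuously satisfied. *)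

(* Defs.v *)
From mathcomp Require Import all_boot all_order all_algebra.
From mathcomp Require Import boolp classical_sets reals.

Set Implicit Arguments.
Unset Strict Implicit.
Unset Printing Implicit Defensive.

Import Order.TTheory GRing.Theory Num.Theory.

Local Open Scope classical_set_scope.
Local Open Scope ring_scope.

(* Relational, so that nothing is the maximum or minimum of the empty set: a
   bound assumed of every maximum or minimum is then vacuous. *)
Definition is_max (A : set nat) (a : nat) : Prop := A a /\ ubound A a.
Definition is_min (A : set nat) (a : nat) : Prop := A a /\ lbound A a.

Definition even_idx (k : nat) (n : 'I_k -> nat) : set 'I_k :=
  [set j | ~~ odd (n j)].
Definition odd_idx (k : nat) (n : 'I_k -> nat) : set 'I_k := ~` even_idx n.

Definition vec (R : realType) (k : nat) (n : 'I_k -> nat) : 'rV[R]_k :=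
  \row_j (n j)%:R.

Definition center (R : realType) (k : nat) (n : 'I_k -> nat) : 'rV[R]_k :=
  \row_j (if odd (n j) then ((n j)%:R - 1) / 2 else (n j)%:R / 2).

Definition cube (R : realType) (k : nat) (m : 'rV[R]_k) : set 'rV[R]_k :=
  [set m + y | y in [set y : 'rV[R]_k |
     forall j, 1 / (k%:R + 1) <= y ord0 j <= k%:R / (k%:R + 1)]].

Definition cone (R : realType) (k : nat) (m : 'rV[R]_k) : set 'rV[R]_k :=
  [set l *: x | l in [set l : R | 0 <= l] & x in cube m].

Definition dist_int (R : realType) (x : R) : R :=
  inf [set `|x - z%:~R| | z in [set: int]].

(* Positivity of the speeds [n j] is left to the statements that use it. *)
Definition lonely_runner_instance (R : realType) (k : nat) (n : 'I_k -> nat) :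
    Prop :=
  exists t : R, forall j, 1 / (k%:R + 1) <= dist_int (t * (n j)%:R).

(* Main.v *)
Require Import Defs.
From mathcomp Require Import all_boot all_order all_algebra.
From mathcomp Require Import boolp classical_sets reals.
From mathcomp Require Import ring lra.

Set Implicit Arguments.
Unset Strict Implicit.
Unset Printing Implicit Defensive.

Import Order.TTheory GRing.Theory Num.Theory.

Local Open Scope classical_set_scope.
Local Open Scope ring_scope.

(* Scaling [vec n] by [t = 1/2 + s] and subtracting [center n] leaves [s * n j]
   at the even entries and [1/2 + s * n j] at the odd ones. If some entry is
   even, and [b] is the least such entry, then [s = 1 / ((k + 1) * b)] puts all
   of these in [1/(k+1), k/(k+1)]; if all entries are odd, [s = 0] does. *)

(** An integer [w <= z] is at distance at least [x - z] from [x], any other satisfies [w >= z + 1]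
    and is at distance at least [z + 1 - x]. *)
Lemma dist_int_ge (R : realType) (x c : R) (z : int) :
  c <= x - z%:~R <= 1 - c -> c <= dist_int x.
Proof.
move=> /andP[cx xc]; apply: lb_le_inf; first by exists `|x - 0%:~R|, 0.
move=> _ [w _ <-]; have [wz|] := lerP w z.
  have wzR : w%:~R <= z%:~R :> R by rewrite ler_int.
  by apply: le_trans (ler_norm _); lra.
rewrite -lezD1 => zw.
have zwR : z%:~R + 1 <= w%:~R :> R by rewrite -[1]/(1%:~R) -intrD ler_int.
by rewrite distrC; apply: le_trans (ler_norm _); lra.
Qed.

(** Shows that the center is an integer vector, so that subtracting it does not change distances to
    the nearest integer. *)
Lemma centerE (R : realType) (k : nat) (n : 'I_k -> nat) (j : 'I_k) :
  center R n ord0 j = (n j)./2%:R.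
Proof.
rewrite mxE -[in (n j)%:R](odd_double_half (n j)) natrD -muln2 natrM.
by case: (odd (n j)) => /=; lra.
Qed.

Lemma is_max_image (I : finType) (f : I -> nat) (A : set I) (i : I) :
  A i -> exists a, is_max [set f j | j in A] a.
Proof.
move=> /asboolP Ai; case: (arg_maxnP (P := fun i => `[< A i >]) f Ai) => m /asboolP Am mmax.
exists (f m); split; first by exists m.
by move=> _ [j Aj <-]; exact/mmax/asboolP.
Qed.

Lemma is_min_image (I : finType) (f : I -> nat) (A : set I) (i : I) :
  A i -> exists b, is_min [set f j | j in A] b.
Proof.
move=> /asboolP Ai; case: (arg_minnP (P := fun i => `[< A i >]) f Ai) => m /asboolP Am mmin.
exists (f m); split; first by exists m.
by move=> _ [j Aj <-]; exact/mmin/asboolP.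
Qed.

Lemma cone_shift (R : realType) (k : nat) (m v : 'rV[R]_k) (t : R) :
  0 < t ->
  (forall j, 1 / (k%:R + 1) <= t * v ord0 j - m ord0 j <= k%:R / (k%:R + 1)) ->
  cone m v.
Proof.
move=> t0 tP; exists t^-1; first by rewrite /= invr_ge0 ltW.
exists (t *: v); last by rewrite scalerA mulVf ?scale1r ?gt_eqF.
by exists (t *: v - m); [move=> j; rewrite !mxE; exact: tP | rewrite addrC subrK].
Qed.

(** The same [t] serves twice: its inverse is the scalar for membership in the cone, and [t] itself
    is the time at which the runners are lonely. *)
Lemma exists_shift (R : realType) (k : nat) (n : 'I_k -> nat) :
  (1 <= k)%N -> (forall j, (0 < n j)%N) ->
  (forall a b : nat,
     is_max [set n j | j in odd_idx n] a ->
     is_min [set n j | j in even_idx n] b ->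
     a%:R <= (k%:R - 1) / 2 * b%:R :> R) ->
  (forall a b : nat,
     is_max [set n j | j in even_idx n] a ->
     is_min [set n j | j in even_idx n] b ->
     a%:R <= k%:R * b%:R :> R) ->
  exists2 t : R, 0 < t &
    forall j, 1 / (k%:R + 1) <= t * (n j)%:R - center R n ord0 j
              <= k%:R / (k%:R + 1).
Proof.
move=> k1 n0 odd_even even_even.
have kR : 1 <= k%:R :> R by rewrite ler1n.
have K0 : 0 < k%:R + 1 :> R by lra.
have [[i ei]|noE] := pselect (exists i, even_idx n i); last first.
  exists (1 / 2) => [|j]; first by lra.
  have oj : odd (n j) by apply/negPn/negP => ej; apply: noE; exists j.
  (* Every difference is [1 / 2], which lies in the interval since [k >= 1]. *)
  by rewrite mxE oj ler_pdivrMr // ler_pdivlMr //; apply/andP; split; lra.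
have [b bmin] := is_min_image n ei.
have b0 : 0 < b%:R :> R by case: bmin => -[l _ <-] _; rewrite ltr0n.
pose s : R := ((k%:R + 1) * b%:R)^-1.
have s0 : 0 < s by rewrite invr_gt0 mulr_gt0.
exists (1 / 2 + s) => [|j]; first by lra.
have sE : s * (n j)%:R * (k%:R + 1) = (n j)%:R / b%:R.
  by rewrite /s; field; rewrite !gt_eqF.
(* Clearing [k + 1] leaves, by [sE], the bounds [1 <= (k + 1) / 2 + n j / b <= k] for odd [n j] and
   [1 <= n j / b <= k] for even [n j]. *)
rewrite mxE ler_pdivrMr // ler_pdivlMr //.
have [oj|ej] := boolP (odd (n j)).
  have Oj : odd_idx n j by move=> /negP.
  have [a amax] := is_max_image n Oj.
  have nja : (n j)%:R <= a%:R :> R by rewrite ler_nat; apply: amax.2; exists j.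
  have := le_trans nja (odd_even _ _ amax bmin); rewrite -(ler_pdivrMr _ _ b0) => hi.
  have lo : 0 <= (n j)%:R / b%:R :> R by rewrite divr_ge0.
  by apply/andP; split; lra.
have [a amax] := @is_max_image _ n (even_idx n) _ ej.
have nja : (n j)%:R <= a%:R :> R by rewrite ler_nat; apply: amax.2; exists j.
have := le_trans nja (even_even _ _ amax bmin); rewrite -(ler_pdivrMr _ _ b0) => hi.
(* Here the minimality of [b] among the even entries enters. *)
have lo : 1 <= (n j)%:R / b%:R :> R.
  by rewrite ler_pdivlMr // mul1r ler_nat; apply: bmin.2; exists j.
by apply/andP; split; lra.
Qed.

(* MathComp-Analysis world. In the two max/min hypotheses [is_max] and [is_min]
   fail on the empty set, so each hypothesis is vacuous when a maximum or
   minimum occurring in it is taken over an empty set. *)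
Theorem theorem5 (R : realType) (k : nat) (n : 'I_k -> nat)
    (k_ge1 : (1 <= k)%N)
    (n_gt0 : forall j : 'I_k, (0 < n j)%N)
    (n_noninc : forall i j : 'I_k, (i <= j)%N -> (n j <= n i)%N)
    (odd_even : forall a b : nat,
       is_max [set n j | j in odd_idx n] a ->
       is_min [set n j | j in even_idx n] b ->
       a%:R <= (k%:R - 1) / 2 * b%:R :> R)
    (even_even : forall a b : nat,
       is_max [set n j | j in even_idx n] a ->
       is_min [set n j | j in even_idx n] b ->
       a%:R <= k%:R * b%:R :> R) :
  cone (center R n) (vec R n) /\ lonely_runner_instance R n.
Proof.
have [t t0 tP] := exists_shift k_ge1 n_gt0 odd_even even_even.
split; first by apply: (cone_shift t0) => j; rewrite [vec _ _ _ _]mxE.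
exists t => j; apply: (@dist_int_ge _ _ _ (n j)./2).
(* The interval is symmetric about [1 / 2], as [dist_int_ge] requires. *)
have -> : 1 - 1 / (k%:R + 1) = k%:R / (k%:R + 1) :> R.
  by rewrite -[X in X - _](@divff _ (k%:R + 1)) -?mulrBl ?addrK // natr1 pnatr_eq0.
by have := tP j; rewrite centerE.
Qed.
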